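(* Let $\mathcal{L}$ be a unimodal signature and let $(\Delta_\alpha,\nabla_\beta)$ be one of the twelve labelled pairs listed in the context with $\Delta_\alpha,\nabla_\beta\in\mathcal{L}$. Then for every $\mathcal{L}$-modal frame $\mathcal{F}$: $\mathcal{F}$ satisfies the frame condition $(\Delta_\alpha,\nabla_\beta)$ if and only if its complex algebra $\mathcal{F}^{+}$ satisfies the quasiequation $(\Delta_\alpha,\nabla_\beta)$ (for all elements $a,b,c$).
   Context: All distributive lattices are bounded. Modal symbols: $\Box_{+},\Box_{-},\Diamond_{+},\Diamond_{-}$; a unimodal signature $\mathcal{L}$ is a subset of these. An $\mathcal{L}$-modal algebra is a bounded distributive lattice with one unary operation per symbol in $\mathcal{L}$ satisfying the applicable identities $\Box_{+}(a\wedge b)=\Box_{+}a\wedge\Box_{+}b$, $\Box_{+}\top=\top$; $\Box_{-}(a\vee b)=\Box_{-}a\wedge\Box_{-}b$, $\Box_{-}\bot=\top$; $\Diamond_{+}(a\vee b)=\Diamond_{+}a\vee\Diamond_{+}b$, $\Diamond_{+}\bot=\bot$; $\Diamond_{-}(a\wedge b)=\Diamond_{-}a\vee\Diamond_{-}b$, $\Diamond_{-}\top=\bot$. For relations $S,T$, $x\,(S\circ T)\,z$ iff $xSy$ and $yTz$ for some $y$. On a poset $(W,\leq)$, $R\subseteq W\times W$ is a $\Box_{+}$-relation if ${\leq}\circ R\circ{\leq}\subseteq R$, a $\Box_{-}$-relation if ${\leq}\circ R\circ{\geq}\subseteq R$, a $\Diamond_{+}$-relation if ${\geq}\circ R\circ{\geq}\subseteq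 R$, a $\Diamond_{-}$-relation if ${\geq}\circ R\circ{\leq}\subseteq R$. An $\mathcal{L}$-modal frame is a poset $(W,\leq)$ with a $\Delta_\alpha$-relation $R^{\Delta}_{\alpha}$ for each $\Delta_\alpha\in\mathcal{L}$. Its complex algebra $\mathcal{F}^{+}$ is the lattice of upsets of $(W,\leq)$ with $\Box_{+}a=\{u:\forall v\,(uR^{\Box}_{+}v\Rightarrow v\in a)\}$, $\Box_{-}a=\{u:\forall v\,(uR^{\Box}_{-}v\Rightarrow v\notin a)\}$, $\Diamond_{+}a=\{u:\exists v\in a,\ uR^{\Diamond}_{+}v\}$, $\Diamond_{-}a=\{u:\exists v\notin a,\ uR^{\Diamond}_{-}v\}$. Quasiequations (for all $a,b,c$): $(\Box_{+},\Box_{-})$: $\Box_{-}a\wedge\Box_{+}(a\vee b)\leq\Box_{+}b$; $(\Box_{-},\Box_{+})$: $\Box_{+}a\wedge\Box_{-}(a\wedge b)\leq\Box_{-}b$; $(\Diamond_{+},\Diamond_{-})$: $\Diamond_{+}b\leq\Diamond_{+}(a\wedge b)\vee\Diamond_{-}a$; $(\Diamond_{-},\Diamond_{+})$: $\Diamond_{-}b\leq\Diamond_{-}(a\vee b)\vee\Diamond_{+}a$; $(\Box_{+},\Diamond_{-})$: $\Diamond_{-}a\wedge c\leq\Box_{+}a\Rightarrow c\leq\Box_{+}a$; $(\Box_{-},\Diamond_{+})$: $\Diamond_{+}a\wedge c\leq\Box_{-}a\Rightarrow c\leq\Box_{-}a$; $(\Diamond_{+},\Box_{-})$: $\Diamond_{+}a\leq\Box_{-}a\vee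 c\Rightarrow\Diamond_{+}a\leq c$; $(\Diamond_{-},\Box_{+})$: $\Diamond_{-}a\leq\Box_{+}a\vee c\Rightarrow\Diamond_{-}a\leq c$; $(\Box_{+},\Diamond_{+})$: $\Diamond_{+}b\wedge c\leq\Box_{+}a\Rightarrow\Box_{+}(a\vee b)\wedge c\leq\Box_{+}a$; $(\Box_{-},\Diamond_{-})$: $\Diamond_{-}b\wedge c\leq\Box_{-}a\Rightarrow\Box_{-}(a\wedge b)\wedge c\leq\Box_{-}a$; $(\Diamond_{+},\Box_{+})$: $\Diamond_{+}a\leq\Box_{+}b\vee c\Rightarrow\Diamond_{+}a\leq\Diamond_{+}(a\wedge b)\vee c$; $(\Diamond_{-},\Box_{-})$: $\Diamond_{-}a\leq\Box_{-}b\vee c\Rightarrow\Diamond_{-}a\leq\Diamond_{-}(a\vee b)\vee c$. Frame conditions: $(\Box_{+},\Box_{-})$: $R^{\Box}_{+}\subseteq(R^{\Box}_{+}\cap R^{\Box}_{-})\circ{\leq}$; $(\Box_{-},\Box_{+})$: $R^{\Box}_{-}\subseteq(R^{\Box}_{-}\cap R^{\Box}_{+})\circ{\geq}$; $(\Diamond_{+},\Diamond_{-})$: $R^{\Diamond}_{+}\subseteq(R^{\Diamond}_{+}\cap R^{\Diamond}_{-})\circ{\geq}$; $(\Diamond_{-},\Diamond_{+})$: $R^{\Diamond}_{-}\subseteq(R^{\Diamond}_{-}\cap R^{\Diamond}_{+})\circ{\leq}$; $(\Box_{+},\Diamond_{-})$: $R^{\Box}_{+}\subseteq{\leq}\circ(R^{\Box}_{+}\cap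 R^{\Diamond}_{-})$; $(\Box_{-},\Diamond_{+})$: $R^{\Box}_{-}\subseteq{\leq}\circ(R^{\Box}_{-}\cap R^{\Diamond}_{+})$; $(\Diamond_{+},\Box_{-})$: $R^{\Diamond}_{+}\subseteq{\geq}\circ(R^{\Diamond}_{+}\cap R^{\Box}_{-})$; $(\Diamond_{-},\Box_{+})$: $R^{\Diamond}_{-}\subseteq{\geq}\circ(R^{\Diamond}_{-}\cap R^{\Box}_{+})$; $(\Box_{+},\Diamond_{+})$: if $uR^{\Box}_{+}v$ then there are $u'\geq u$, $v'\leq v$ with $u'R^{\Box}_{+}v$, $uR^{\Box}_{+}v'$, $u'R^{\Diamond}_{+}v'$; $(\Box_{-},\Diamond_{-})$: if $uR^{\Box}_{-}v$ then there are $u'\geq u$, $v'\geq v$ with $u'R^{\Box}_{-}v$, $uR^{\Box}_{-}v'$, $u'R^{\Diamond}_{-}v'$; $(\Diamond_{+},\Box_{+})$: if $uR^{\Diamond}_{+}v$ then there are $u'\leq u$, $v'\geq v$ with $u'R^{\Diamond}_{+}v$, $uR^{\Diamond}_{+}v'$, $u'R^{\Box}_{+}v'$; $(\Diamond_{-},\Box_{-})$: if $uR^{\Diamond}_{-}v$ then there are $u'\leq u$, $v'\leq v$ with $u'R^{\Diamond}_{-}v$, $uR^{\Diamond}_{-}v'$, $u'R^{\Box}_{-}v'$. *)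

(* Defs.v *)
From HB Require Import structures.
From mathcomp Require Import all_boot all_order.
From mathcomp Require Import boolp classical_sets.

Set Implicit Arguments.
Unset Strict Implicit.
Unset Printing Implicit Defensive.

Import Order.TTheory.

Local Open Scope order_scope.

Inductive modal_symbol := BoxP | BoxM | DiaP | DiaM.

Definition modal_symbol_code (s : modal_symbol) : bool * bool :=
  match s with
  | BoxP => (true, true) | BoxM => (true, false)
  | DiaP => (false, true) | DiaM => (false, false)
  end.

Definition modal_symbol_decode (c : bool * bool) : modal_symbol :=
  match c with
  | (true, true) => BoxP | (true, false) => BoxM
  | (false, true) => DiaP | (false, false) => DiaM
  end.

Lemma modal_symbol_codeK : cancel modal_symbol_code modal_symbol_decode.
Proof. by case. Qed.

HB.instance Definition _ :=
  Finite.copy modal_symbol (can_type modal_symbol_codeK).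

Notation signature := {set modal_symbol}.

Definition modal_identities (d : Order.disp_t) (A : tbDistrLatticeType d)
    (s : modal_symbol) (f : A -> A) : Prop :=
  match s with
  | BoxP => (forall a b, f (a `&` b) = f a `&` f b) /\ f \top = \top
  | BoxM => (forall a b, f (a `|` b) = f a `&` f b) /\ f \bot = \top
  | DiaP => (forall a b, f (a `|` b) = f a `|` f b) /\ f \bot = \bot
  | DiaM => (forall a b, f (a `&` b) = f a `|` f b) /\ f \top = \bot
  end.

Record modalAlgebra (d : Order.disp_t) (L : signature) := ModalAlgebra {
  malg_sort :> tbDistrLatticeType d ;
  malg_op : forall s : modal_symbol, s \in L -> malg_sort -> malg_sort ;
  malg_opP : forall (s : modal_symbol) (hs : s \in L),
    modal_identities s (malg_op hs)
}.

(* Left-to-right composition, the opposite of the order of [\;] in the        *)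
(* relation_scope of classical_sets.                                          *)
Definition rcomp (W : Type) (S T : W -> W -> Prop) : W -> W -> Prop :=
  fun x z => exists y, S x y /\ T y z.

Definition rsub (W : Type) (S T : W -> W -> Prop) : Prop :=
  forall x y, S x y -> T x y.

Definition rcap (W : Type) (S T : W -> W -> Prop) : W -> W -> Prop :=
  fun x y => S x y /\ T x y.

Definition rle (d : Order.disp_t) (W : porderType d) : W -> W -> Prop :=
  fun x y => x <= y.

Definition rge (d : Order.disp_t) (W : porderType d) : W -> W -> Prop :=
  fun x y => x >= y.

Definition modal_relation (d : Order.disp_t) (W : porderType d)
    (s : modal_symbol) (R : W -> W -> Prop) : Prop :=
  let le := @rle d W in
  let ge := @rge d W in
  match s with
  | BoxP => rsub (rcomp (rcomp le R) le) R
  | BoxM => rsub (rcomp (rcomp le R) ge) R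
  | DiaP => rsub (rcomp (rcomp ge R) ge) R
  | DiaM => rsub (rcomp (rcomp ge R) le) R
  end.

Record modalFrame (d : Order.disp_t) (L : signature) := ModalFrame {
  world :> porderType d ;
  acc : forall s : modal_symbol, s \in L -> world -> world -> Prop ;
  accP : forall (s : modal_symbol) (hs : s \in L), modal_relation s (acc hs)
}.

Section Upsets.
Context (d : Order.disp_t) (W : porderType d).
Implicit Types A B : set W.

Definition is_upset A : Prop := forall x y : W, x <= y -> A x -> A y.

Definition upset_pred : pred (set W) := fun A => `[< is_upset A >].

Record upset := Upset { upset_val :> set W ; upset_valP : upset_pred upset_val }.

HB.instance Definition _ := [isSub for upset_val].
HB.instance Definition _ := [Choice of upset by <:].

Lemma upsetP (A : upset) : is_upset A.
Proof. exact/asboolP/upset_valP. Qed.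

Definition mk_upset A (hA : is_upset A) : upset := Upset (asboolT hA).

Lemma upset_meet_closed : meet_closed upset_pred.
Proof.
move=> A B /asboolP hA /asboolP hB; apply/asboolP => x y xy [Ax Bx].
by split; [exact: hA Ax|exact: hB Bx].
Qed.

Lemma upset_join_closed : join_closed upset_pred.
Proof.
move=> A B /asboolP hA /asboolP hB; apply/asboolP => x y xy [Ax|Bx].
  by left; exact: hA Ax.
by right; exact: hB Bx.
Qed.

Lemma upset_bot : (\bot : set W) \in upset_pred.
Proof. by apply/asboolP. Qed.

Lemma upset_top : (\top : set W) \in upset_pred.
Proof. by apply/asboolP. Qed.

HB.instance Definition _ :=
  Order.SubChoice_isTBSubLattice.Build _ (set W) upset_pred set_display upset
    upset_meet_closed upset_join_closed upset_bot upset_top.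

Lemma upset_meetUl : @left_distributive upset upset Order.meet Order.join.
Proof. by move=> A B C; apply: val_inj; exact: meetUl. Qed.

HB.instance Definition _ :=
  Order.Lattice_Meet_isDistrLattice.Build set_display upset upset_meetUl.

Lemma upset_ext (A B : upset) : (forall u, upset_val A u <-> upset_val B u) -> A = B.
Proof. by move=> AB; apply: val_inj; apply/seteqP; split=> u /AB. Qed.

Lemma le_upsetP (A B : upset) : A <= B <-> (forall u, upset_val A u -> upset_val B u).
Proof. by split=> [/asboolP|AB]; [|apply/asboolP]. Qed.

Lemma upset_meetE (A B : upset) u : upset_val (A `&` B) u <->
  upset_val A u /\ upset_val B u.
Proof. by []. Qed.

Lemma upset_joinE (A B : upset) u : upset_val (A `|` B) u <->
  upset_val A u \/ upset_val B u.
Proof. by []. Qed.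

Lemma upset_topE u : upset_val \top u <-> True.
Proof. by []. Qed.

Lemma upset_botE u : upset_val \bot u <-> False.
Proof. by []. Qed.

Definition complex_set (s : modal_symbol) (R : W -> W -> Prop) A : set W :=
  match s with
  | BoxP => fun u => forall v, R u v -> A v
  | BoxM => fun u => forall v, R u v -> ~ A v
  | DiaP => fun u => exists v, A v /\ R u v
  | DiaM => fun u => exists v, ~ A v /\ R u v
  end.

Lemma complex_set_upset s R A :
  modal_relation s R -> is_upset (complex_set s R A).
Proof.
case: s => /= hR x y xy.
- by move=> hx v yv; apply/hx/hR; exists v; split; [exists y|exact: lexx].
- by move=> hx v yv; apply/hx/hR; exists v; split; [exists y|exact: lexx].
- move=> [v [Av xv]]; exists v; split=> //.
  by apply/hR; exists v; split; [exists x|exact: lexx].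
- move=> [v [Av xv]]; exists v; split=> //.
  by apply/hR; exists v; split; [exists x|exact: lexx].
Qed.

Definition complex_op (s : modal_symbol) (R : W -> W -> Prop)
    (hR : modal_relation s R) (A : upset) : upset :=
  mk_upset (@complex_set_upset s R A hR).

Lemma complex_op_identities s R (hR : modal_relation s R) :
  modal_identities s (complex_op hR).
Proof.
case: s hR => hR; split=> [A B|]; apply: upset_ext => u; split => //=.
- by move=> h; split=> v /h [].
- by move=> [hA hB] v uv; split; [exact: hA|exact: hB].
- by move=> h; split=> v /h hv ?; apply: hv; [left|right].
- by move=> [hA hB] v uv [Av|Bv]; [exact: hA Av|exact: hB Bv].
- by move=> h v _ [].
- by move=> [v [[Av|Bv] uv]]; [left|right]; exists v.
- by move=> [[v [hv uv]]|[v [hv uv]]]; exists v; split=> //; [left|right].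
- by move=> [v [[]]].
- move=> [v [hv uv]]; have [Av|nAv] := EM (upset_val A v).
    by right; exists v; split=> // Bv; exact: hv.
  by left; exists v.
- by move=> [[v [hv uv]]|[v [hv uv]]]; exists v; split=> // -[].
- by move=> [v [/(_ I)]].
Qed.

End Upsets.

Definition complex_algebra (d : Order.disp_t) (L : signature)
    (F : modalFrame d L) : modalAlgebra set_display L :=
  @ModalAlgebra set_display L (upset F)
    (fun s hs => complex_op (@accP d L F s hs))
    (fun s hs => complex_op_identities (@accP d L F s hs)).

(* The ordered pairs of distinct modal symbols.                               *)
Inductive modal_pair :=
  | BoxP_BoxM | BoxM_BoxP | DiaP_DiaM | DiaM_DiaP
  | BoxP_DiaM | BoxM_DiaP | DiaP_BoxM | DiaM_BoxP
  | BoxP_DiaP | BoxM_DiaM | DiaP_BoxP | DiaM_BoxM.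

Definition pair_fst (p : modal_pair) : modal_symbol :=
  match p with
  | BoxP_BoxM | BoxP_DiaM | BoxP_DiaP => BoxP
  | BoxM_BoxP | BoxM_DiaP | BoxM_DiaM => BoxM
  | DiaP_DiaM | DiaP_BoxM | DiaP_BoxP => DiaP
  | DiaM_DiaP | DiaM_BoxP | DiaM_BoxM => DiaM
  end.

Definition pair_snd (p : modal_pair) : modal_symbol :=
  match p with
  | BoxM_BoxP | DiaM_BoxP | DiaP_BoxP => BoxP
  | BoxP_BoxM | DiaP_BoxM | DiaM_BoxM => BoxM
  | DiaM_DiaP | BoxM_DiaP | BoxP_DiaP => DiaP
  | DiaP_DiaM | BoxP_DiaM | BoxM_DiaM => DiaM
  end.

(* [f] interprets the first symbol of the pair and [g] the second: in the     *)
(* case BoxP_BoxM, [f] is the operation of BoxP and [g] that of BoxM.         *)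
Definition quasiequation (d : Order.disp_t) (L : signature)
    (A : modalAlgebra d L) (p : modal_pair)
    (h1 : pair_fst p \in L) (h2 : pair_snd p \in L) : Prop :=
  let f := @malg_op d L A _ h1 in
  let g := @malg_op d L A _ h2 in
  match p with
  | BoxP_BoxM => forall a b : A, g a `&` f (a `|` b) <= f b
  | BoxM_BoxP => forall a b : A, g a `&` f (a `&` b) <= f b
  | DiaP_DiaM => forall a b : A, f b <= f (a `&` b) `|` g a
  | DiaM_DiaP => forall a b : A, f b <= f (a `|` b) `|` g a
  | BoxP_DiaM => forall a c : A, g a `&` c <= f a -> c <= f a
  | BoxM_DiaP => forall a c : A, g a `&` c <= f a -> c <= f a
  | DiaP_BoxM => forall a c : A, f a <= g a `|` c -> f a <= c
  | DiaM_BoxP => forall a c : A, f a <= g a `|` c -> f a <= c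
  | BoxP_DiaP => forall a b c : A,
      g b `&` c <= f a -> f (a `|` b) `&` c <= f a
  | BoxM_DiaM => forall a b c : A,
      g b `&` c <= f a -> f (a `&` b) `&` c <= f a
  | DiaP_BoxP => forall a b c : A,
      f a <= g b `|` c -> f a <= f (a `&` b) `|` c
  | DiaM_BoxM => forall a b c : A,
      f a <= g b `|` c -> f a <= f (a `|` b) `|` c
  end.

(* [R] is the relation of the first symbol of the pair, [S] of the second.    *)
Definition frame_condition (d : Order.disp_t) (L : signature)
    (F : modalFrame d L) (p : modal_pair)
    (h1 : pair_fst p \in L) (h2 : pair_snd p \in L) : Prop :=
  let R := @acc d L F _ h1 in
  let S := @acc d L F _ h2 in
  let le := @rle d F in
  let ge := @rge d F in
  match p with
  | BoxP_BoxM => rsub R (rcomp (rcap R S) le)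
  | BoxM_BoxP => rsub R (rcomp (rcap R S) ge)
  | DiaP_DiaM => rsub R (rcomp (rcap R S) ge)
  | DiaM_DiaP => rsub R (rcomp (rcap R S) le)
  | BoxP_DiaM => rsub R (rcomp le (rcap R S))
  | BoxM_DiaP => rsub R (rcomp le (rcap R S))
  | DiaP_BoxM => rsub R (rcomp ge (rcap R S))
  | DiaM_BoxP => rsub R (rcomp ge (rcap R S))
  | BoxP_DiaP => forall u v : F, R u v ->
      exists u' v', [/\ u <= u', v' <= v, R u' v, R u v' & S u' v']
  | BoxM_DiaM => forall u v : F, R u v ->
      exists u' v', [/\ u <= u', v <= v', R u' v, R u v' & S u' v']
  | DiaP_BoxP => forall u v : F, R u v ->
      exists u' v', [/\ u' <= u, v <= v', R u' v, R u v' & S u' v']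
  | DiaM_BoxM => forall u v : F, R u v ->
      exists u' v', [/\ u' <= u, v' <= v, R u' v, R u v' & S u' v']
  end.

(* Main.v *)
Require Import Defs.
From mathcomp Require Import all_boot all_order.
From mathcomp Require Import boolp classical_sets.

Set Implicit Arguments.
Unset Strict Implicit.
Unset Printing Implicit Defensive.

(** Up to complementing sets, each of the four operations is the box
    [{u | forall v, R u v -> A v}]: replacing [A] by its complement accounts for
    [BoxM], complementing argument and value for [DiaP], complementing the value
    for [DiaM]. Complementation turns upsets into upsets of the reversed order,
    so the twelve pairs become the instances, for independent choices of
    orientation of the order on the source ([o]) and on the target ([i]) of the
    relations, of three correspondences. In each of them, given [R u v], the
    quasiequation is tested at [u] on an instance whose conclusion [box R a] (or
    [box R b]) has [{w | ~ w <= v}] as argument, and so fails at [u], and with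
    [c := {w | u <= w}]; here [<=] is the reoriented order. *)

Local Open Scope order_scope.
Local Open Scope classical_set_scope.

Lemma setC_sub (T : Type) (A B : set T) : (~` A `<=` B) = (~` B `<=` A).
Proof. by rewrite propeqE; split; exact: subsetCl. Qed.

(** Contraposition: a join on the right of a diamond inequality becomes a meet on the left, as in
    the box form. *)
Lemma setC_subU (T : Type) (A B C : set T) :
  (~` A `<=` B `|` C) = (~` B `&` ~` C `<=` A).
Proof. by rewrite setC_sub setCU. Qed.

Section Orientation.
Context (d : Order.disp_t) (W : porderType d).
Implicit Types (A : set W) (R S : W -> W -> Prop) (a b c : upset W).

Definition oriented_le (s : bool) : W -> W -> Prop :=
  if s then @rle d W else @rge d W.

Definition oriented_set (s : bool) A : set W := if s then A else ~` A.

Definition rel_closed (e1 e2 : W -> W -> Prop) R : Prop :=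
  rsub (rcomp (rcomp e1 R) e2) R.

Definition box R A : set W := [set u | forall v, R u v -> A v].

Lemma oriented_le_refl s x : oriented_le s x x.
Proof. by case: s; exact: Order.POrderTheory.lexx. Qed.

Lemma oriented_le_trans s x y z :
  oriented_le s x y -> oriented_le s y z -> oriented_le s x z.
Proof.
by case: s => xy yz; [exact: Order.POrderTheory.le_trans xy yz|
                      exact: Order.POrderTheory.le_trans yz xy].
Qed.

Lemma oriented_leN s x y : oriented_le (~~ s) x y = oriented_le s y x.
Proof. by case: s. Qed.

Lemma rel_closedP o i R x x' y y' :
  rel_closed (oriented_le o) (oriented_le i) R ->
  oriented_le o x' x -> oriented_le i y y' -> R x y -> R x' y'.
Proof. by move=> Rc x'x yy' xy; apply: Rc; exists y; split=> //; exists x. Qed.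

Lemma oriented_set_upper s a x y :
  oriented_le s x y -> oriented_set s a x -> oriented_set s a y.
Proof.
case: s => [xy|yx nax ay]; first exact: upsetP xy.
exact/nax/(upsetP yx).
Qed.

(** Supplies the elements at which quasiequations are tested; for the reversed order, the complement
    of [A] is the upset. *)
Lemma oriented_setP s A :
  (forall x y, oriented_le s x y -> A x -> A y) ->
  exists a : upset W, oriented_set s a = A.
Proof.
case: s => Aup; first by exists (mk_upset Aup).
have nAup : is_upset (~` A) by move=> x y xy nAx Ay; exact/nAx/(Aup y).
by exists (mk_upset nAup); exact: setCK.
Qed.

Lemma oriented_set_up s u : exists a, oriented_set s a = oriented_le s u.
Proof. by apply: oriented_setP => x y xy ux; exact: oriented_le_trans ux xy. Qed.

Lemma oriented_set_ndown s v :
  exists a, oriented_set s a = [set w | ~ oriented_le s w v].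
Proof.
apply: oriented_setP => x y xy /= nxv yv; apply: nxv.
exact: oriented_le_trans xy yv.
Qed.

Lemma box_box_correspondence o i R S :
  rel_closed (oriented_le o) (oriented_le i) R ->
  rel_closed (oriented_le o) (oriented_le (~~ i)) S ->
  rsub R (rcomp (rcap R S) (oriented_le i)) <->
  forall a b, box S (~` oriented_set i a)
              `&` box R (oriented_set i a `|` oriented_set i b)
              `<=` box R (oriented_set i b).
Proof.
move=> Rc Sc; split=> [RS a b u [Sa Rab] v /RS [w [[uw uSw] wv]]|q u v uv].
  by case: (Rab w uw) => [/(Sa w uSw)//|]; exact: oriented_set_upper.
(* The largest set disjoint from the [S]-successors of [u]; it is upward closed because [S] is
   closed downward in its target. *)
have [a aE] : exists a, oriented_set i a = [set w | ~ S u w].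
  apply: oriented_setP => x y xy /= nSx Sy; apply: nSx.
  by apply: (rel_closedP Sc) Sy; rewrite ?oriented_leN //; exact: oriented_le_refl.
have [b bE] := oriented_set_ndown i v.
have := q a b u; rewrite aE bE => {}q; apply: contrapT => nRS.
suff /q/(_ v uv) : (box S (~` [set w | ~ S u w])
    `&` box R ([set w | ~ S u w] `|` [set w | ~ oriented_le i w v])) u.
  by apply; exact: oriented_le_refl.
(* An [R]-successor of [u] in neither set would be an [S]-successor below [v], the witness that
   [nRS] excludes. *)
split=> [w uw /(_ uw)//|w uw].
have [uSw|] := EM (S u w); last by left.
by right=> wv; apply: nRS; exists w.
Qed.

Lemma box_ndia_correspondence o i R S :
  rel_closed (oriented_le o) (oriented_le i) R ->
  rel_closed (oriented_le (~~ o)) (oriented_le i) S ->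
  rsub R (rcomp (oriented_le o) (rcap R S)) <->
  forall a c,
    ~` box S (oriented_set i a) `&` oriented_set o c
      `<=` box R (oriented_set i a) ->
    oriented_set o c `<=` box R (oriented_set i a).
Proof.
move=> Rc Sc; split=> [RS a c h u cu v /RS [u' [uu' [u'v Su'v]]]|q u v uv].
  (* If [v] were outside [a], [S u' v] would put [u'] in the left side of [h], and [R u' v] would
     then force [v] into [a]. *)
  apply: contrapT => nav; apply: (nav); apply: h u'v; split.
    by move=> /(_ v Su'v).
  exact: oriented_set_upper uu' cu.
have [a aE] := oriented_set_ndown i v.
have [c cE] := oriented_set_up o u.
have := q a c; rewrite aE cE => {}q; apply: contrapT => nRS.
suff /q/(_ u (oriented_le_refl o u) v uv) :
    ~` box S [set w | ~ oriented_le i w v] `&` oriented_le o u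
    `<=` box R [set w | ~ oriented_le i w v].
  by apply; exact: oriented_le_refl.
(* An [R]-successor [w] and an [S]-successor [w'] of [u'], both below [v], can be raised to [v], so
   [u'] is a witness. *)
move=> u' [+ uu'] w u'w wv; apply=> w' Su'w' w'v; apply: nRS.
exists u'; split=> //; split.
  by apply: (rel_closedP Rc) u'w => //; exact: oriented_le_refl.
by apply: (rel_closedP Sc) Su'w' => //; exact: oriented_le_refl.
Qed.

Lemma box_dia_correspondence o i R S :
  rel_closed (oriented_le o) (oriented_le i) R ->
  rel_closed (oriented_le (~~ o)) (oriented_le (~~ i)) S ->
  (forall u v, R u v -> exists u' v',
     [/\ oriented_le o u u', oriented_le i v' v, R u' v, R u v' & S u' v']) <->
  forall a b c,
    ~` box S (~` oriented_set i b) `&` oriented_set o c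
      `<=` box R (oriented_set i a) ->
    box R (oriented_set i a `|` oriented_set i b) `&` oriented_set o c
      `<=` box R (oriented_set i a).
Proof.
move=> Rc Sc; split=> [RS a b c h u [Rab cu] v|q u v uv].
  move=> /RS [u' [v' [uu' v'v u'v uv' Su'v']]].
  case: (Rab v' uv') => [|bv']; first exact: oriented_set_upper.
  apply: h u'v; split; last exact: oriented_set_upper uu' cu.
  by move=> /(_ v' Su'v').
have [a aE] := oriented_set_ndown i v.
(* [a] misses exactly the points below [v], so this is the least upward closed set that together
   with [a] covers the [R]-successors of [u]. *)
have [b bE] : exists b, oriented_set i b =
    [set w' | exists w, [/\ R u w, oriented_le i w v & oriented_le i w w']].
  apply: oriented_setP => x y xy /= [w [uw wv wx]]; exists w; split=> //.
  exact: oriented_le_trans wx xy.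
have [c cE] := oriented_set_up o u.
apply: contrapT => nRS; have := q a b c _ u _ v uv; rewrite aE bE cE.
apply; last exact: oriented_le_refl.
(* [w'] lies above some [v'] below [v] with [R u v']; lowering [w'] to [v'] and raising [w] to [v]
   gives the excluded pair. *)
- move=> u' [+ uu'] w u'w wv; apply=> w' Su'w' [v' [uv' v'v v'w']].
  apply: nRS; exists u', v'; split=> //.
    by apply: (rel_closedP Rc) u'w => //; exact: oriented_le_refl.
  apply: (rel_closedP Sc) Su'w'; rewrite ?oriented_leN //.
  exact: oriented_le_refl.
- split=> [w uw|]; last exact: oriented_le_refl.
  have [wv|] := EM (oriented_le i w v); last by left.
  by right; exists w; split=> //; exact: oriented_le_refl.
Qed.

Lemma le_upsetE a b :
  (is_true (a <= b)) = (upset_val a `<=` upset_val b).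
Proof. by rewrite propeqE; exact: le_upsetP. Qed.

Lemma upset_val_meet a b : upset_val (a `&` b)%O = upset_val a `&` upset_val b.
Proof. by []. Qed.

Lemma upset_val_join a b : upset_val (a `|` b)%O = upset_val a `|` upset_val b.
Proof. by []. Qed.

Lemma complex_set_BoxP R A : complex_set BoxP R A = box R A.
Proof. by []. Qed.

Lemma complex_set_BoxM R A : complex_set BoxM R A = box R (~` A).
Proof. by []. Qed.

Lemma complex_set_DiaP R A : complex_set DiaP R A = ~` box R (~` A).
Proof.
apply/seteqP; split=> u; first by move=> [v [Av uv]] /(_ v uv).
move=> h; apply: contrapT => nex; apply: h => v uv Av.
by apply: nex; exists v.
Qed.

Lemma complex_set_DiaM R A : complex_set DiaM R A = ~` box R A.
Proof. by rewrite -[in RHS](setCK A) -complex_set_DiaP. Qed.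

Lemma upset_val_complex_op s R (hR : modal_relation s R) a :
  upset_val (complex_op hR a) = complex_set s R a.
Proof. by []. Qed.

(** Turns inequalities of the complex algebra into inclusions between sets built from [box] and
    Boolean operations. *)
Definition complexE := (le_upsetE, upset_val_meet, upset_val_join,
  upset_val_complex_op, complex_set_BoxP, complex_set_BoxM, complex_set_DiaP,
  complex_set_DiaM).

End Orientation.

Theorem mainTheorem2 (d : Order.disp_t) (L : signature) (p : modal_pair)
    (h1 : pair_fst p \in L) (h2 : pair_snd p \in L) (F : modalFrame d L) :
  frame_condition F h1 h2 <-> quasiequation (complex_algebra F) h1 h2.
Proof.
have := @accP d L F _ h2; have := @accP d L F _ h1.
case: p h1 h2 => h1 h2 Rc Sc; rewrite /frame_condition /quasiequation.
(* The booleans are [o] and [i] for the first symbol: [true true] for [BoxP], [true false] for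
   [BoxM], [false false] for [DiaP], [false true] for [DiaM]. *)
- apply: iff_trans (@box_box_correspondence _ _ true true _ _ Rc Sc) _.
  by split=> q a b; move/(_ a b): q; rewrite !complexE.
- apply: iff_trans (@box_box_correspondence _ _ true false _ _ Rc Sc) _.
  by split=> q a b; move/(_ a b): q; rewrite !complexE /= setCK setCI.
- apply: iff_trans (@box_box_correspondence _ _ false false _ _ Rc Sc) _.
  by split=> q a b; move/(_ a b): q;
    rewrite !complexE /= setCK -setCI -setCI setCS setIC.
- apply: iff_trans (@box_box_correspondence _ _ false true _ _ Rc Sc) _.
  by split=> q a b; move/(_ a b): q;
    rewrite !complexE /= -setCI setCS setIC.
- apply: iff_trans (@box_ndia_correspondence _ _ true true _ _ Rc Sc) _.
  by split=> q a c; move/(_ a c): q; rewrite !complexE.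
- apply: iff_trans (@box_ndia_correspondence _ _ true false _ _ Rc Sc) _.
  by split=> q a c; move/(_ a c): q; rewrite !complexE.
- apply: iff_trans (@box_ndia_correspondence _ _ false false _ _ Rc Sc) _.
  by split=> q a c; move/(_ a c): q; rewrite !complexE /= setC_subU setC_sub.
- apply: iff_trans (@box_ndia_correspondence _ _ false true _ _ Rc Sc) _.
  by split=> q a c; move/(_ a c): q; rewrite !complexE /= setC_subU setC_sub.
- apply: iff_trans (@box_dia_correspondence _ _ true true _ _ Rc Sc) _.
  by split=> q a b c; move/(_ a b c): q; rewrite !complexE.
- apply: iff_trans (@box_dia_correspondence _ _ true false _ _ Rc Sc) _.
  by split=> q a b c; move/(_ a b c): q; rewrite !complexE /= setCI setCK.
- apply: iff_trans (@box_dia_correspondence _ _ false false _ _ Rc Sc) _.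
  by split=> q a b c; move/(_ a b c): q; rewrite !complexE /= !setC_subU setCI !setCK.
- apply: iff_trans (@box_dia_correspondence _ _ false true _ _ Rc Sc) _.
  by split=> q a b c; move/(_ a b c): q; rewrite !complexE /= !setC_subU setCK.
Qed.
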